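(* Let $p$ be a prime and let $k$ be a field of characteristic $p$. Let $\Delta$ be a connected simplicial pseudomanifold of dimension $d-1$ that is oriented over $k$ and has vertex set $V=\{1,\dots,n\}$. Let $I$ be a $d\times n$ matrix of nonnegative integers such that all row sums are $p-1$. Let $J$ be a $1\times n$ matrix of nonnegative integers with row sum $d$. Then, in $K=k(a_{i,j})_{1\le i\le d,\,1\le j\le n}$, $$\partial^I\deg(x^J)=(-1)^d\deg\big((x^I\cdot x^J)^{1/p}\big)^p.$$
   Context: A simplicial pseudomanifold of dimension $d-1$ is a pure simplicial complex $\Delta$ of dimension $d-1$ such that every $(d-2)$-dimensional face lies in exactly two facets, and each connected component of the geometric realization of $\Delta$ remains connected after removing its $(d-3)$-skeleton. ''Oriented over $k$'' means that an orientation over $k$ is fixed: each facet $F=\{j_1<\dots<j_d\}$ is given an ordering of its vertices up to even permutation, recorded by the sign $\epsilon_F\in\{1,-1\}$ of the permutation taking $(j_1,\dots,j_d)$ to this ordering, such that $\sum_F \epsilon_F\,[j_1,\dots,j_d]$ is a simplicial cycle with coefficients in $k$. $K=k(a_{i,j})_{1\le i\le d,\,1\le j\le n}$ is the field of rational functions in the variables $a_{i,j}$; $K[\Delta]$ is the Stanley–Reisner ring of $\Delta$ over $K$ (the quotient of $K[x_1,\dots,x_n]$ by the squarefree monomials of non-faces); $\mu_i=\sum_j a_{i,j}x_j$ for $1\le i\le d$; $H(\Delta)=K[\Delta]/(\mu_1,\dots,\mu_d)$ is the generic artinian reduction, a graded ring. $H^d(\Delta)$ is $1$-dimensional over $K$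 and is spanned by the monomial $x^F=\prod_{j\in F}x_j$ of any facet $F$. The degree map $\deg\colon K[x_1,\dots,x_n]_d\to H^d(\Delta)\to K$ is the $K$-linear map, factoring through an isomorphism $H^d(\Delta)\cong K$, determined by $\deg(x^F)=\epsilon_F/[F]$ for every facet $F=\{j_1<\dots<j_d\}$, where $[F]$ is the determinant of the $d\times d$ matrix with $(i,m)$ entry $a_{i,j_m}$. For a matrix $L=(\nu_{i,j})$ of nonnegative integers with $n$ columns, $x^L=\prod_{i,j}x_j^{\nu_{i,j}}=\prod_j x_j^{\sum_i\nu_{i,j}}$. For a monomial $y$ in the $x_j$, $y^{1/p}$ denotes the monomial whose $p$th power is $y$ if it exists, and $0$ otherwise. For a $d\times n$ matrix $I=(I_{i,j})$ of nonnegative integers, $\partial^I=\prod_{i,j}\left(\frac{\partial}{\partial a_{i,j}}\right)^{I_{i,j}}$, a differential operator acting on $K$. *)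

(* Defs.v *)
From mathcomp Require Import all_boot all_order all_algebra.
From mathcomp Require boolp classical_sets topology normedtype.
From mathcomp Require Import generic_quotient fraction reals mpoly ring.

Set Implicit Arguments.
Unset Strict Implicit.
Unset Printing Implicit Defensive.

Import GRing.Theory.
Local Open Scope ring_scope.

(* A complex on {1, ..., n} is the set of its faces, including the empty face;
   a face G has dimension #|G| - 1. *)
Section Complexes.
Variable n : nat.
Implicit Types (Delta : {set {set 'I_n}}) (F G : {set 'I_n}).

Record simplicial_complex Delta : Prop := SimplicialComplex {
  complex0 : set0 \in Delta;
  complexS : forall F G, F \in Delta -> G \subset F -> G \in Delta;
  complex1 : forall i, [set i] \in Delta
}.

Definition facets Delta : {set {set 'I_n}} :=
  [set F | maxset (fun G => G \in Delta) F].

(* The faces of dimension at most d - 3. *)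
Definition codim2_skeleton d Delta : {set {set 'I_n}} :=
  [set G in Delta | #|G|.+2 <= d]%N.

End Complexes.

(* The imports are confined to this module because the notations of
   MathComp-Analysis clash with those of mpoly. *)
Module Topology.
Import boolp classical_sets topology normedtype numFieldNormedType.Exports.
Local Open Scope classical_set_scope.

Section Realization.
Variables (R : realType) (n : nat).
Implicit Types (Delta : {set {set 'I_n}}).

(* Barycentric coordinates: the support of a point is the face whose relative
   interior contains it. *)
Definition realization Delta : set 'rV[R]_n :=
  [set x | [/\ forall i, 0 <= x 0 i, \sum_i x 0 i = 1
             & finset (fun i => x 0 i != 0) \in Delta]].

Definition connected_complex Delta : Prop := connected (realization Delta).

Definition components_remain_connected d Delta : Prop :=
  forall x, realization Delta x ->
    connected (connected_component (realization Delta) x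
               `\` realization (codim2_skeleton d Delta)).

End Realization.
End Topology.
Notation realization := Topology.realization.
Notation connected_complex := Topology.connected_complex.
Notation components_remain_connected := Topology.components_remain_connected.

(* Dimension d - 1; R is the model of the real numbers in which the geometric
   realization is taken. *)
Record pseudomanifold (R : realType) (d n : nat) (Delta : {set {set 'I_n}})
    : Prop := Pseudomanifold {
  pm_complex : simplicial_complex Delta;
  pm_pure : forall F, F \in facets Delta -> #|F| = d;
  pm_ridge : forall G, G \in Delta -> #|G|.+1 = d ->
    #|[set F in facets Delta | G \subset F]| = 2%N;
  pm_components : components_remain_connected R d Delta
}.

Section Orientation.
Variables (k : fieldType) (n : nat).

(* A chain is given by the coefficients of the faces with increasingly ordered
   vertices; enum F lists the elements of F in increasing order. *)
Definition boundary (c : {ffun {set 'I_n} -> k}) : {ffun {set 'I_n} -> k} :=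
  [ffun G : {set 'I_n} =>
    \sum_(F : {set 'I_n}) \sum_(j in F | F :\ j == G)
      (-1) ^+ index j (enum F) * c F].

(* eps F is the parity of the chosen ordering of F, so that the sign epsilon_F
   is (-1) ^+ eps F. *)
Definition fundamental_chain (Delta : {set {set 'I_n}})
    (eps : {set 'I_n} -> bool) : {ffun {set 'I_n} -> k} :=
  [ffun F : {set 'I_n} => if F \in facets Delta then (-1) ^+ eps F else 0].

Definition orientation Delta eps : Prop :=
  boundary (fundamental_chain Delta eps) = 0.

End Orientation.

Section FractionDerivation.
Variables (D : idomainType) (der : D -> D).

(* The quotient rule; by frac_derivE it does not depend on the representative. *)
Definition frac_deriv (x : {fraction D}) : {fraction D} :=
  let u := (frac (repr x)).1 in let v := (frac (repr x)).2 in
  tofrac (der u * v - u * der v) / tofrac (v ^+ 2).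

Lemma frac_derivE (u v : D) :
  (forall f g, der (f * g) = der f * g + f * der g) -> v != 0 ->
  frac_deriv (tofrac u / tofrac v)
  = tofrac (der u * v - u * der v) / tofrac (v ^+ 2).
Proof.
move=> derM v0; rewrite /frac_deriv; set x := tofrac u / tofrac v.
set a := (frac (repr x)).1; set b := (frac (repr x)).2.
have b0 : b != 0 by apply: denom_ratioP.
have xb : x * tofrac b = tofrac a.
  rewrite -[x]reprK; unlock tofrac; rewrite -[LHS]FracField.pi_mul.
  apply/eqP; rewrite FracField.equivf_def /FracField.mulf.
  by rewrite !numden_Ratio ?oner_neq0 ?mulr1 ?mulf_neq0 ?denom_ratioP // mulrC.
have xv : x * tofrac v = tofrac u by rewrite /x divfK ?tofrac_eq0.
have E : a * v = u * b.
  by apply/eqP; rewrite -tofrac_eq !tofracM -xb mulrAC xv.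
have E' := congr1 der E; rewrite !derM in E'.
apply/eqP; rewrite eqr_div ?tofrac_eq0 ?expf_neq0 // -!tofracM tofrac_eq.
apply/eqP; have h : der a * v = der u * b + u * der b - a * der v.
  by rewrite -E' addrK.
transitivity (der a * v * (b * v) - a * v * (der b * v)); first by ring.
rewrite h E.
transitivity (der u * b * b * v - a * v * (der v * b)); first by ring.
by rewrite E; ring.
Qed.

End FractionDerivation.

(* k[a_ij], whose variables are numbered by mxvec_index, and K = k(a_ij). *)
Definition polydom (k : fieldType) (d n : nat) : idomainType :=
  {mpoly k[(d * n)%N]}.

Definition ratfield (k : fieldType) (d n : nat) : fieldType :=
  {fraction polydom k d n}.

Section GenericReduction.
Variables (k : fieldType) (d n : nat).
Local Notation K := (ratfield k d n).
Implicit Types (Delta : {set {set 'I_n}}) (F : {set 'I_n}).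

Definition avar (i : 'I_d) (j : 'I_n) : K :=
  tofrac ('X_(mxvec_index i j) : polydom k d n).

Definition mu (i : 'I_d) : {mpoly K[n]} := \sum_j avar i j *: 'X_j.

Definition sqfree_mon F : {mpoly K[n]} := \prod_(j in F) 'X_j.

(* The kernel of K[x_1, ..., x_n] -> H(Delta): the sum of the Stanley-Reisner
   ideal and of (mu_1, ..., mu_d). *)
Definition reduction_ideal Delta (f : {mpoly K[n]}) : Prop :=
  exists (q : {set 'I_n} -> {mpoly K[n]}) (r : 'I_d -> {mpoly K[n]}),
    f = \sum_(G | G \notin Delta) q G * sqfree_mon G + \sum_i r i * mu i.

Definition bracket F : K :=
  \det (\matrix_(i < d, m < d) [seq avar i j | j <- enum F]`_m).

(* Only the values of deg on forms of degree d matter. The condition on the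
   kernel says that deg induces an injective map on H^d(Delta); it is onto
   because its values on facets are nonzero. *)
Record degree_map Delta (eps : {set 'I_n} -> bool) (deg : {mpoly K[n]} -> K)
    : Prop := DegreeMap {
  degree_linear : forall (c : K) (f g : {mpoly K[n]}),
    f \is d.-homog -> g \is d.-homog -> deg (c *: f + g) = c * deg f + deg g;
  degree_ker : forall f : {mpoly K[n]},
    f \is d.-homog -> deg f = 0 <-> reduction_ideal Delta f;
  degree_facet : forall F, F \in facets Delta ->
    deg (sqfree_mon F) = (-1) ^+ eps F / bracket F
}.

Definition pderiv (i : 'I_d) (j : 'I_n) : K -> K :=
  frac_deriv (mderiv (mxvec_index i j) : polydom k d n -> polydom k d n).

Definition pderiv_mx (I : 'M[nat]_(d, n)) : K -> K :=
  \big[(fun f g : K -> K => f \o g)/id]_(i < d)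
    \big[(fun f g : K -> K => f \o g)/id]_(j < n) iter (I i j) (pderiv i j).

End GenericReduction.

(* The exponent of the monomial x^L. *)
Definition mx_expo (m n : nat) (L : 'M[nat]_(m, n)) : 'X_{1..n} :=
  [multinom (\sum_i L i j)%N | j < n].

(* y^(1/p) for the monomial y with exponent e. *)
Definition mon_root (A : nzRingType) (n p : nat) (e : 'X_{1..n}) : {mpoly A[n]} :=
  if [forall j, p %| e j]%N then 'X_[[multinom (e j %/ p)%N | j < n]] else 0.

(* Main.v *)
Require Import Defs.
From HB Require Import structures.
From mathcomp Require Import all_boot all_order all_algebra.
From mathcomp Require Import fraction reals mpoly ring.

Set Implicit Arguments.
Unset Strict Implicit.
Unset Printing Implicit Defensive.

Import GRing.Theory.
Local Open Scope ring_scope.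

(** The degree map is written as a sum over facets, and the operator is moved
    from the coefficients [a_ij] to auxiliary variables.

    Let [v] be a generic vector of length [d]. For a facet [F] let [x_F] be the
    solution of [sum_j a_ij x_j = v_i] supported on [F]; its entries are linear
    forms in [v]. Lee's formula
    [L(f) = sum_F eps_F / [F] * f(x_F) / prod_(j in F) x_F(j)]
    defines a functional on all polynomials (here [lee], on monomials). It kills
    the non-faces, and multiplication of [f] by [mu_i] multiplies [L(f)] by
    [v_i]. The orientation cycle makes [L] vanish in degrees below [d]
    ([lee_ridge], [lee_sqfree_small], [lee_small]). Hence in degree [d] it kills
    the ideal of the generic reduction, and since it has the right values on
    facets it is the degree map ([extend_deg]).

    Moving the column of [j] moves [x_F] as moving [v] backwards does, so that
    [d/da_ij L(f) = - d/dv_i L(x_j f)] ([lee_der]). Therefore [d^I deg(x^J)] is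
    [Psi(x^(I+J))], where [Psi] is [L] followed by [p - 1] derivatives in each
    [v_i]. The sign is a [d (p - 1)]st power of [-1], which is 1 in
    characteristic [p].

    The functional [Psi], in degree [d p], depends on [K[x_1, ..., x_n]] only
    modulo the non-faces and the [p]th powers of the [mu_i]: these act as
    [v_i^p], a constant for the derivations, on forms of degree [d p - p], which
    [Psi] kills ([foldr_lee_small]). As [mu_i^p = sum_j a_ij^p x_j^p], an
    exponent above [p] at a vertex of a facet can be traded by [p] for vertices
    outside the facet. These are the [p]th powers of the trades that determine
    [L] in degree [d], so [Psi(x^E)] and [(-1)^d L(x^(E/p))^p] obey the same
    rules ([lee_frobenius]), with [x^(E/p) = 0] when [p] does not divide [E].
    The trades end at non-faces, where both sides vanish, or at [p] times the
    indicator of a facet [F]. There the equality says that the diagonal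
    derivative of order [p - 1] in each row takes [1/[F]] to
    [(p - 1)!^d / [F]^p] ([lee_frobenius_facet]), which is clear from
    [1/[F] = [F]^(p-1) / [F]^p] because a determinant is affine in each entry
    ([diag_der_det]). *)

(** * Derivations *)

Record derivation (A : nzRingType) (D : A -> A) : Prop := Derivation {
  derD : {morph D : x y / x + y};
  derM : forall x y, D (x * y) = D x * y + x * D y
}.

Section DerivationRing.
Variables (A : nzRingType) (D : A -> A) (dD : derivation D).
Implicit Types x y : A.

Lemma der0 : D 0 = 0.
Proof. by apply: (addrI (D 0)); rewrite -(derD dD) !addr0. Qed.

Lemma der1 : D 1 = 0.
Proof.
apply: (addrI (D 1)); rewrite addr0.
by have := derM dD 1 1; rewrite !mulr1 mul1r => <-.
Qed.

Lemma derN x : D (- x) = - D x.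
Proof. by apply: (addrI (D x)); rewrite -(derD dD) !subrr der0. Qed.

Lemma der_sum (J : Type) (r : seq J) (P : pred J) (F : J -> A) :
  D (\sum_(j <- r | P j) F j) = \sum_(j <- r | P j) D (F j).
Proof. by apply: big_morph; [exact: derD | exact: der0]. Qed.

Lemma der_prod0 (J : Type) (r : seq J) (P : pred J) (F : J -> A) :
  (forall j, D (F j) = 0) -> D (\prod_(j <- r | P j) F j) = 0.
Proof.
move=> F0; elim/big_ind: _ => //; first exact: der1.
by move=> x y x0 y0; rewrite (derM dD) x0 y0 mul0r mulr0 addr0.
Qed.

Lemma der_sign n : D ((-1) ^+ n) = 0.
Proof.
elim: n => [|n IH]; first by rewrite expr0 der1.
by rewrite exprS mulN1r derN IH oppr0.
Qed.

Lemma der_nat m : D m%:R = 0.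
Proof.
by elim: m => [|m IH]; rewrite ?der0 // mulrSr (derD dD) IH der1 addr0.
Qed.

Lemma derZ0 c x : D c = 0 -> D (c * x) = c * D x.
Proof. by move=> c0; rewrite (derM dD) c0 mul0r add0r. Qed.

End DerivationRing.

Section DerivationComRing.
Variables (A : comNzRingType) (D : A -> A) (dD : derivation D).
Implicit Types x y : A.

Lemma derX x m : D (x ^+ m) = m%:R * x ^+ m.-1 * D x.
Proof.
elim: m => [|m IH]; first by rewrite expr0 (der1 dD) !mul0r.
rewrite exprS (derM dD) IH; case: m {IH} => [|m] /=.
  by rewrite !expr0; ring.
by rewrite exprS; ring.
Qed.

Lemma der_pchar p x : p \in [pchar A] -> D (x ^+ p) = 0.
Proof. by move=> charA; rewrite derX (pcharf0 charA) !mul0r. Qed.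

Lemma der_det0 m (M : 'M[A]_m) : (forall i j, D (M i j) = 0) -> D (\det M) = 0.
Proof.
move=> M0; rewrite /determinant (der_sum dD) big1 // => s _.
by rewrite (derZ0 dD) ?der_sign // (der_prod0 dD) ?mulr0.
Qed.

(** Expand along column [j], the only one that [D] does not kill. *)
Lemma der_det_entry m (M : 'M[A]_m) i j :
  (forall i' j', D (M i' j') = ((i' == i) && (j' == j))%:R) ->
  D (\det M) = cofactor M i j.
Proof.
move=> DM; rewrite (expand_det_col M j) (der_sum dD) (bigD1 i) //=.
have Dcof i' : D (cofactor M i' j) = 0.
  rewrite /cofactor (derZ0 dD) ?der_sign // der_det0 ?mulr0 // => a b.
  by rewrite !mxE DM [X in _ && X]eq_sym (negPf (neq_lift _ _)) andbF.
rewrite big1 => [|i' i'i]; last first.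
  by rewrite (derM dD) Dcof DM (negPf i'i) mul0r mulr0 addr0.
by rewrite (derM dD) Dcof DM !eqxx mul1r mulr0 !addr0.
Qed.

(** Each application lowers the exponent of [u] by one and brings out a factor
    [w], which behaves as a constant. *)
Lemma iter_der_exp q c u w : D c = 0 -> D u = w -> D w = 0 ->
  iter q D (c * u ^+ q) = q`!%:R * c * w ^+ q.
Proof.
move=> + Du Dw; elim: q c => [|q IH] c Dc; first by rewrite fact0 mul1r.
rewrite iterSr (derZ0 dD) // derX /= Du.
have -> : c * (q.+1%:R * u ^+ q * w) = (q.+1%:R * c * w) * u ^+ q by ring.
rewrite IH ?factS ?natrM; first by rewrite [w ^+ q.+1]exprS; ring.
by rewrite -mulrA !(derM dD) (der_nat dD) Dc Dw !(mul0r, mulr0, addr0).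
Qed.

End DerivationComRing.

Section DiagonalDerivative.
Variables (A : comNzRingType) (T : Type) (D : T -> A -> A).
Hypothesis dD : forall t, derivation (D t).

(** Apply the innermost operators first: each one differentiates in the last
    diagonal entry, which turns the determinant into its leading minor. *)
Lemma diag_der_det q m (M : 'M[A]_m) (t : 'I_m -> T) (c : A) :
  (forall l, D (t l) c = 0) ->
  (forall l i j, D (t l) (M i j) = ((i == l) && (j == l))%:R) ->
  foldr D (c * \det M ^+ q) (\big[cat/[::]]_(l < m) nseq q (t l))
  = q`!%:R ^+ m * c.
Proof.
elim: m M t c => [|m IH] M t c Dc DM.
  by rewrite big_ord0 /= det_mx00 expr1n expr0 mul1r mulr1.
rewrite big_ord_recr /= foldr_cat.
have foldr_nseq b z : foldr D z (nseq b (t ord_max)) = iter b (D (t ord_max)) z.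
  by elim: b => //= b ->.
pose M' : 'M_m := row' ord_max (col' ord_max M).
have detM' : cofactor M ord_max ord_max = \det M'.
  by rewrite /cofactor addnn -signr_odd odd_double mul1r.
have lm (l : 'I_m) : lift ord_max l = widen_ord (leqnSn m) l.
  by apply: val_inj; rewrite /= /bump leqNgt ltn_ord.
have DM'0 : D (t ord_max) (\det M') = 0.
  apply: (der_det0 (dD _)) => i j; rewrite !mxE DM.
  by rewrite eq_sym (negPf (neq_lift _ _)).
have Dt : D (t ord_max) (\det M) = \det M'.
  by rewrite -detM'; apply: der_det_entry.
rewrite foldr_nseq (iter_der_exp (dD _) _ (Dc _) Dt DM'0).
rewrite IH.
- by rewrite exprSr mulrA.
- by move=> l; rewrite (derM (dD _)) (der_nat (dD _)) Dc mul0r mulr0 addr0.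
- move=> l i j; rewrite !mxE DM !lm.
  by rewrite -!lm !(inj_eq lift_inj).
Qed.

End DiagonalDerivative.

Section DerivationField.
Variables (K : fieldType) (D : K -> K) (dD : derivation D).

Lemma derV x : D x^-1 = - D x / x ^+ 2.
Proof.
have [->|x0] := eqVneq x 0; first by rewrite invr0 (der0 dD) oppr0 mul0r.
have := congr1 D (mulfV x0); rewrite (derM dD) (der1 dD) => /eqP.
rewrite addr_eq0 => /eqP Dx; apply: (mulfI x0).
by rewrite -[LHS]opprK -Dx; field.
Qed.

End DerivationField.

Section FoldDerivations.
Variables (A : nzRingType) (T : Type) (D : T -> A -> A).
Hypothesis dD : forall t, derivation (D t).

Lemma foldr_der0 w : foldr D 0 w = 0.
Proof. by elim: w => //= t w ->; apply: der0. Qed.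

Lemma foldr_derD w x y : foldr D (x + y) w = foldr D x w + foldr D y w.
Proof. by elim: w => //= t w ->; rewrite (derD (dD t)). Qed.

Lemma foldr_derN w x : foldr D (- x) w = - foldr D x w.
Proof. by elim: w => //= t w ->; rewrite (derN (dD t)). Qed.

Lemma foldr_der_sum w (J : Type) (r : seq J) (P : pred J) (F : J -> A) :
  foldr D (\sum_(j <- r | P j) F j) w = \sum_(j <- r | P j) foldr D (F j) w.
Proof.
apply: (big_morph (fun x => foldr D x w)); last exact: foldr_der0.
exact: foldr_derD.
Qed.

Lemma foldr_derZ w c x : (forall t, D t c = 0) ->
  foldr D (c * x) w = c * foldr D x w.
Proof. by move=> Dc; elim: w => //= t w ->; rewrite (derZ0 (dD t)). Qed.

End FoldDerivations.

(** * The vertices of a facet as coordinates *)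

Section FacetCoordinates.
Variables (d n : nat).
Implicit Types (F G : {set 'I_n}) (u j h : 'I_n).

Lemma enum_card_nth F (m : 'I_d) : #|F| = d ->
  exists2 j, j \in F & (index j (enum F) = m) /\
    forall j', (m == index j' (enum F) :> nat) = (j' == j).
Proof.
move=> Fd; have ltm : (m < size (enum F))%N by rewrite -cardE Fd.
have [j0 _] : exists j, j \in enum F.
  by move: ltm; case: (enum F) => [|j s] // _; exists j; rewrite mem_head.
have jF : nth j0 (enum F) m \in enum F by rewrite mem_nth.
have ij : index (nth j0 (enum F) m) (enum F) = m.
  by rewrite index_uniq ?enum_uniq.
exists (nth j0 (enum F) m); first by rewrite -mem_enum.
split=> // j'; apply/eqP/eqP => [mj'|->]; last by rewrite ij.
by rewrite mj' nth_index // -index_mem -mj'.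
Qed.

Lemma enum_setD1 F u : enum (F :\ u) = rem u (enum F).
Proof.
rewrite (rem_filter u (enum_uniq F)) /enum_mem -filter_predI.
by apply: eq_filter => j; rewrite /= !inE.
Qed.

Lemma nth_rem (T : eqType) (x0 x : T) (s : seq T) c : x \in s ->
  nth x0 (rem x s) c = nth x0 s (bump (index x s) c).
Proof.
rewrite -index_mem => lt_xs; rewrite remE nth_cat size_take lt_xs /bump.
by case: ltnP => [lt_c|le_c]; rewrite ?nth_take // nth_drop addSn subnKC.
Qed.

Variables (K : fieldType) (a : 'I_d -> 'I_n -> K).

Definition colmx F : 'M[K]_d := \matrix_(i, m) [seq a i j | j <- enum F]`_m.

Lemma colmxE F (m : 'I_d) j i :
  j \in F -> index j (enum F) = m -> colmx F i m = a i j.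
Proof.
move=> jF ij; rewrite mxE (nth_map j) -ij ?index_mem ?mem_enum //.
by rewrite nth_index ?mem_enum.
Qed.

(** For [u] in [F], the linear form on [K^d] that is 1 on the column of [u] and
    0 on the other columns of [F]; for [u] outside [F] the sum is empty. *)
Definition dual_form F u (i : 'I_d) : K :=
  \sum_(m < d | m == index u (enum F) :> nat) invmx (colmx F) m i.

Variable F : {set 'I_n}.
Hypothesis (cardF : #|F| = d) (unitF : \det (colmx F) != 0).

Let uF : colmx F \in unitmx. Proof. by rewrite unitmxE unitfE. Qed.

Lemma dual_form_out u i : u \notin F -> dual_form F u i = 0.
Proof.
move=> uF'; rewrite /dual_form big1 // => m /eqP mu.
have: (index u (enum F) < size (enum F))%N by rewrite -mu -cardE cardF.
by rewrite index_mem mem_enum (negPf uF').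
Qed.

Lemma dual_form_in u : u \in F -> exists2 m : 'I_d,
  index u (enum F) = m & forall i, dual_form F u i = invmx (colmx F) m i.
Proof.
move=> uF'; have lt_u : (index u (enum F) < d)%N.
  by rewrite -[X in (_ < X)%N]cardF cardE index_mem mem_enum.
exists (Ordinal lt_u) => // i.
by rewrite /dual_form (big_pred1 (Ordinal lt_u)).
Qed.

Lemma dual_formE u j : u \in F -> j \in F ->
  \sum_i dual_form F u i * a i j = (j == u)%:R.
Proof.
move=> uF' jF; have [m um dE] := dual_form_in uF'.
have [m' jm _] := dual_form_in jF.
transitivity ((invmx (colmx F) *m colmx F) m m').
  by rewrite mxE; apply: eq_bigr => i _; rewrite dE (colmxE i jF jm).
rewrite mulVmx // mxE; congr (nat_of_bool _)%:R; apply/eqP/eqP => [mm|ju].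
  have: index j (enum F) = index u (enum F) by rewrite um jm mm.
  by apply: index_inj; rewrite ?mem_enum.
by apply: val_inj; rewrite /= -um -jm ju.
Qed.

Lemma sum_dual_form i l : \sum_j a i j * dual_form F j l = (i == l)%:R.
Proof.
transitivity ((colmx F *m invmx (colmx F)) i l); last by rewrite mulmxV // mxE.
under eq_bigr do rewrite big_distrr /=.
rewrite (exchange_big_dep xpredT) //= mxE; apply: eq_bigr => m _.
have [j jF [jm Ej]] := enum_card_nth m cardF.
by rewrite (big_pred1 j) // (colmxE _ jF jm).
Qed.

Lemma dual_form_neq0 u : u \in F -> exists i, dual_form F u i != 0.
Proof.
move=> uF'; apply/existsP; rewrite -negb_forall; apply/forallP => d0.
have := dual_formE uF' uF'; rewrite eqxx big1 => [/eqP|i _].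
  by rewrite eq_sym oner_eq0.
by rewrite (eqP (d0 i)) mul0r.
Qed.

(** The point of the cone over [F], in the coordinates given by its vertices,
    at which the parameters [mu i] take the values [v i]. *)
Definition cone_coord (v : 'I_d -> K) u : K := \sum_i dual_form F u i * v i.

Lemma cone_coord_out v u : u \notin F -> cone_coord v u = 0.
Proof.
by move=> uF'; rewrite /cone_coord big1 // => i _; rewrite dual_form_out ?mul0r.
Qed.

Lemma cone_coordE v i : \sum_j a i j * cone_coord v j = v i.
Proof.
under eq_bigr do rewrite big_distrr /=.
rewrite exchange_big /= (bigD1 i) //= [X in _ + X]big1 ?addr0 => [|l li].
  under eq_bigr do rewrite mulrA.
  by rewrite -big_distrl /= sum_dual_form eqxx mul1r.
under eq_bigr do rewrite mulrA.
by rewrite -big_distrl /= sum_dual_form eq_sym (negPf li) mul0r.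
Qed.

Lemma cone_coord_uniq v (x : 'I_n -> K) :
  (forall j, j \notin F -> x j = 0) -> (forall i, \sum_j a i j * x j = v i) ->
  forall u, x u = cone_coord v u.
Proof.
move=> x0 xE u; have [uF'|uF'] := boolP (u \in F); last first.
  by rewrite cone_coord_out ?x0.
rewrite /cone_coord; under eq_bigr do rewrite -xE big_distrr /=.
rewrite exchange_big /= (bigD1 u) //= [X in _ + X]big1 ?addr0 => [|j ju].
  under eq_bigr do rewrite mulrA.
  by rewrite -big_distrl /= dual_formE // eqxx mul1r.
under eq_bigr do rewrite mulrA.
rewrite -big_distrl /=.
have [jF|/x0->] := boolP (j \in F); last by rewrite mulr0.
by rewrite dual_formE // (negPf ju) mul0r.
Qed.

(** The determinant of [v] and the columns of [G], expanded along [v]. *)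
Definition ridge_form G (v : 'I_d -> K) : K :=
  \sum_(i < d) (-1) ^+ i * \det (row' i (\matrix_(i < d, m < d.-1)
    [seq a i j | j <- enum G]`_m)) * v i.

(** Cramer's rule: both sides are the determinant of [F] with the column of [u]
    replaced by [v]. *)
Lemma cramer_cone_coord v u : u \in F ->
  \det (colmx F) * cone_coord v u
  = (-1) ^+ index u (enum F) * ridge_form (F :\ u) v.
Proof.
move=> uF'; have [m um dE] := dual_form_in uF'.
rewrite /cone_coord /ridge_form !big_distrr /=; apply: eq_bigr => i _.
rewrite dE [LHS]mulrA [RHS]mulrA; congr (_ * _).
rewrite /invmx uF !mxE mulVKf // /cofactor exprD um.
rewrite -mulrA mulrCA; congr (_ * (_ * \det _)).
apply/matrixP => r c; rewrite !mxE enum_setD1.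
have lt_c : (c < size (enum (F :\ u)))%N.
  by rewrite -cardE (leq_trans (ltn_ord c)) // -cardF (cardsD1 u F) uF'.
have lt_c' : (bump m c < size (enum F))%N
    by rewrite -cardE cardF; apply: (ltn_ord (lift m c)).
by rewrite !(nth_map u) // -?enum_setD1 // enum_setD1 nth_rem ?mem_enum // um.
Qed.

End FacetCoordinates.

(** * Reduction of monomials *)

Section Support.
Variable n : nat.
Implicit Types (E : 'X_{1..n}) (F G : {set 'I_n}) (Delta : {set {set 'I_n}}).

Definition mnm_supp E : {set 'I_n} := [set j | E j != 0%N].

Definition mnm_set F : 'X_{1..n} := [multinom nat_of_bool (j \in F) | j < n].

Lemma mdeg_set F : mdeg (mnm_set F) = #|F|.
Proof.
rewrite mdegE -sum1_card [RHS]big_mkcond; apply: eq_bigr => j _.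
by rewrite mnmE; case: ifP.
Qed.

Lemma mnm_supp_set F : mnm_supp (mnm_set F) = F.
Proof. by apply/setP => j; rewrite inE mnmE; case: (j \in F). Qed.

Lemma mnm_set_supp E : (forall j, (E j <= 1)%N) -> E = mnm_set (mnm_supp E).
Proof.
move=> E1; apply/mnmP => j; rewrite mnmE inE.
by case: (E j) (E1 j) => [|[]].
Qed.

Lemma mnm_supp_add E u q : (0 < q)%N ->
  mnm_supp (E + U_(u) *+ q)%MM = u |: mnm_supp E.
Proof.
move=> q0; apply/setP => j; rewrite !inE mnmDE mulmnE mnm1E [j == u]eq_sym.
have [_|_] /= := eqVneq u j; rewrite ?mul0n ?addn0 // mul1n addn_eq0.
by rewrite negb_and -!lt0n q0 orbT.
Qed.

(** The reduction of monomials modulo the linear forms: an exponent that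
    exceeds [q] at a vertex [u] of a facet is traded, [q] units at a time, for
    vertices outside the facet. Trades enlarge the support, so they end at a
    non-face or at exponents bounded by [q]. The value [q = 1] serves for the
    parameters [mu i], the characteristic for their [p]th powers. *)
Lemma support_ind Delta q (P : 'X_{1..n} -> Prop) : (0 < q)%N ->
  (forall E, mnm_supp E \notin Delta -> P E) ->
  (forall E, mnm_supp E \in Delta -> (forall j, (E j <= q)%N) -> P E) ->
  (forall E F u, F \in facets Delta -> mnm_supp E \subset F -> u \in F ->
     (forall h, h \notin F -> P (E + U_(h) *+ q)%MM) ->
     P (E + U_(u) *+ q)%MM) ->
  forall E, P E.
Proof.
move=> q0 Pout Psmall Ptrade E.
have [m] := ubnP (n - #|mnm_supp E|)%N; elim: m E => // m IH E leEm.
have [ED|/Pout//] := boolP (mnm_supp E \in Delta).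
have [/forallP/Psmall|] := boolP [forall j, (E j <= q)%N]; first exact.
rewrite negb_forall => /existsP[u]; rewrite -ltnNge => ltqu.
have [F maxF sEF] := @maxset_exists _ (fun G => G \in Delta) _ ED.
pose E' := (E - U_(u) *+ q)%MM.
have EE' : E = (E' + U_(u) *+ q)%MM.
  rewrite submK //; apply/mnm_lepP => j; rewrite mulmnE mnm1E.
  by have [<-|_] /= := eqVneq u j; rewrite ?mul1n ?mul0n // ltnW.
have sE' : mnm_supp E = mnm_supp E'.
  apply/setP => j; rewrite !inE mnmBE mulmnE mnm1E.
  have [<-|_] /= := eqVneq u j; rewrite ?mul0n ?subn0 // mul1n.
  rewrite subn_eq0 -ltnNge ltqu.
  by rewrite -lt0n (leq_ltn_trans _ ltqu).
rewrite EE'; apply: (Ptrade _ F).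
- by rewrite inE.
- by rewrite -sE'.
- by apply: (subsetP sEF); rewrite inE -lt0n (leq_ltn_trans _ ltqu).
move=> h hF; apply: IH; rewrite mnm_supp_add // cardsU1 -sE'.
have -> : h \notin mnm_supp E by apply: contra hF; apply: (subsetP sEF).
have := max_card (h |: mnm_supp E); rewrite cardsU1 card_ord.
have -> : h \notin mnm_supp E by apply: contra hF; apply: (subsetP sEF).
by rewrite !add1n subnS -subn_gt0 => lt_n; rewrite prednK.
Qed.

End Support.

(** * The localized degree *)

Section Lee.
Variables (d n : nat) (Delta : {set {set 'I_n}}) (eps : {set 'I_n} -> bool).
Variables (K : fieldType) (a : 'I_d -> 'I_n -> K) (v : 'I_d -> K).
Implicit Types (E : 'X_{1..n}) (F G : {set 'I_n}).

Local Notation x F := (cone_coord a F v).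

(** Lee's formula for the degree map. Only facets that contain the support of
    [E] contribute, because [x F] vanishes outside [F]. *)
Definition lee E : K :=
  \sum_(F in facets Delta) (-1) ^+ eps F / \det (colmx a F) *
    (\prod_j x F j ^+ E j / \prod_(j in F) x F j).

Hypothesis complexD : simplicial_complex Delta.
Hypothesis pureD : forall F, F \in facets Delta -> #|F| = d.
Hypothesis detD : forall F, F \in facets Delta -> \det (colmx a F) != 0.
Hypothesis coordD : forall F u, F \in facets Delta -> u \in F -> x F u != 0.

Let facet_face F : F \in facets Delta -> F \in Delta.
Proof. by rewrite inE => /maxsetp. Qed.

Lemma prod_cone_coord_out F E :
  F \in facets Delta -> ~~ (mnm_supp E \subset F) ->
  \prod_j x F j ^+ E j = 0.
Proof.
move=> FD /subsetPn[j]; rewrite inE => Ej jF.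
by rewrite (bigD1 j) //= cone_coord_out ?pureD // expr0n (negPf Ej) mul0r.
Qed.

Lemma lee_nonface E : mnm_supp E \notin Delta -> lee E = 0.
Proof.
move=> ED; rewrite /lee big1 // => F FD.
rewrite prod_cone_coord_out ?mul0r ?mulr0 //; apply: contra ED.
exact: complexS (facet_face FD).
Qed.

Lemma lee_facet F : F \in facets Delta ->
  lee (mnm_set F) = (-1) ^+ eps F / \det (colmx a F).
Proof.
move=> FD; rewrite /lee (bigD1 F) //= [X in _ + X]big1 ?addr0 => [|G].
  rewrite [X in _ * (X / _)](_ : _ = \prod_(j in F) x F j); last first.
    by rewrite [RHS]big_mkcond; apply: eq_bigr => j _; rewrite mnmE; case: ifP.
  rewrite divff ?mulr1 //; apply/prodf_neq0 => j jF; exact: coordD.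
case/andP=> GD GF; rewrite prod_cone_coord_out ?mul0r ?mulr0 // mnm_supp_set.
apply: contra GF => sFG; rewrite eq_sym eqEcard sFG.
by rewrite (pureD GD) (pureD FD) leqnn.
Qed.

Lemma prod_cone_coord_add F E h q :
  \prod_j x F j ^+ (E + U_(h) *+ q)%MM j = x F h ^+ q * \prod_j x F j ^+ E j.
Proof.
under eq_bigr do rewrite mnmDE mulmnE exprD.
rewrite big_split /= mulrC; congr (_ * _).
rewrite (bigD1 h) //= mnm1E eqxx mul1n big1 ?mulr1 // => j jh.
by rewrite mnm1E eq_sym (negPf jh) mul0n expr0.
Qed.

(** At every facet the values of the [x_j] satisfy the linear relations
    [mu i = v i]; [phi] is the identity or the Frobenius map. *)
Lemma lee_relation (phi : {rmorphism K -> K}) q (lam : 'I_d -> K) E :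
  (forall c, phi c = c ^+ q) ->
  phi (\sum_i lam i * v i) * lee E
  = \sum_h phi (\sum_i lam i * a i h) * lee (E + U_(h) *+ q)%MM.
Proof.
move=> phiE; rewrite /lee big_distrr /=.
under [RHS]eq_bigr do rewrite big_distrr /=.
rewrite [RHS]exchange_big /=; apply: eq_bigr => F FD.
have -> : phi (\sum_i lam i * v i)
    = \sum_h phi (\sum_i lam i * a i h) * x F h ^+ q.
  under eq_bigr => i _.
    rewrite -(cone_coordE (pureD FD) (detD FD) v i) big_distrr; over.
  rewrite exchange_big raddf_sum; apply: eq_bigr => h _ /=.
  rewrite -phiE -rmorphM big_distrl; congr (phi _).
  by apply: eq_bigr => i _; rewrite /= mulrA.
rewrite big_distrl; apply: eq_bigr => h _; rewrite prod_cone_coord_add /=.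
by rewrite -mulrA; congr (_ * _); rewrite mulrCA !mulrA.
Qed.

(** Choose the combination of the linear relations whose coefficient is 1 at
    [u] and 0 at the other vertices of [F]. *)
Lemma lee_trade (phi : {rmorphism K -> K}) q F u E :
  (forall c, phi c = c ^+ q) -> F \in facets Delta -> u \in F ->
  lee (E + U_(u) *+ q)%MM
  = phi (x F u) * lee E - \sum_(h | h \notin F)
      phi (\sum_i dual_form a F u i * a i h) * lee (E + U_(h) *+ q)%MM.
Proof.
move=> phiE FD uF; have cF := pureD FD; have dF := detD FD.
rewrite (lee_relation _ _ phiE) (bigID (mem F)) /= addrK.
rewrite (bigD1 u) //= dual_formE // eqxx rmorph1 mul1r big1 ?addr0 // => h.
by case/andP=> hF hu; rewrite dual_formE // (negPf hu) rmorph0 mul0r.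
Qed.

Section Vanishing.
Variables (k : fieldType) (f : {rmorphism k -> K}).
Hypothesis orD : orientation k Delta eps.

(** By Cramer's rule the facets around the ridge [G] contribute their signs in
    the boundary of the fundamental chain, divided by the same linear form. *)
Lemma lee_ridge G : #|G|.+1 = d -> lee (mnm_set G) = 0.
Proof.
move=> cG; have /ffunP/(_ G) := orD.
rewrite !ffunE => /(congr1 f); rewrite rmorph0 raddf_sum /=.
rewrite (bigID (mem (facets Delta))) /=.
rewrite [X in _ + X]big1 ?addr0 => [|F FD]; last first.
  by rewrite big1 ?rmorph0 // => j _; rewrite ffunE (negPf FD) mulr0.
move=> or0; rewrite -[RHS](mul0r (ridge_form a G v)^-1) -or0 /lee big_distrl /=.
apply: eq_bigr => F FD; rewrite raddf_sum /= big_distrl /=.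
have [sGF|nGF] := boolP (G \subset F); last first.
  rewrite prod_cone_coord_out ?mnm_supp_set // mul0r mulr0.
  rewrite big1 // => j /andP[_ /eqP] FG.
  by rewrite -FG subsetDl in nGF.
have: #|F :\: G| == 1%N.
  by rewrite cardsD (setIidPr sGF) pureD // -cG subSnn.
case/cards1P => u FGu.
have uF : u \in F by have := set11 u; rewrite -FGu inE => /andP[].
have uG : u \notin G by have := set11 u; rewrite -FGu inE => /andP[].
have FuG : F :\ u = G by rewrite -FGu setDDr setDv set0U (setIidPr sGF).
rewrite [RHS](big_pred1 u) => [|j /=]; last first.
  apply/andP/eqP => [[jF /eqP FjG]|->]; last by rewrite uF FuG.
  by apply/set1P; rewrite -FGu inE jF -FjG !inE eqxx.
rewrite ffunE FD !rmorphM !rmorph_sign /=.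
have -> : \prod_j x F j ^+ mnm_set G j = \prod_(j in G) x F j.
  by rewrite [RHS]big_mkcond; apply: eq_bigr => j _; rewrite mnmE; case: ifP.
have -> : \prod_(j in F) x F j = x F u * \prod_(j in G) x F j.
  by rewrite (big_setD1 u) //= FuG.
have G0 : \prod_(j in G) x F j != 0.
  by apply/prodf_neq0 => j jG; apply: coordD => //; apply: (subsetP sGF).
rewrite [X in _ * X](_ : _ = (x F u)^-1); last first.
  by rewrite invfM mulrCA divff // mulr1.
rewrite -mulrA -invfM cramer_cone_coord ?pureD ?detD // FuG invfM invr_sign.
by rewrite mulrA [X in X * _]mulrC.
Qed.

(** Descend from ridges to smaller faces: for a vertex [u] of a facet [F] around
    [G], outside [G], a trade expresses [x F u * lee G] by faces with one more
    vertex, and [x F u] is not zero. *)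
Lemma lee_sqfree_small G : (#|G| < d)%N -> lee (mnm_set G) = 0.
Proof.
have [m] := ubnP (d - #|G|)%N; elim: m G => // m IH G leGm ltGd.
have [GD|GD] := boolP (G \in Delta); last by rewrite lee_nonface ?mnm_supp_set.
have [F maxF sGF] := @maxset_exists _ (fun G => G \in Delta) _ GD.
have FD : F \in facets Delta by rewrite inE.
have [|u uF uG] := subsetPn (_ : ~~ (F \subset G)).
  by apply/negP => /subset_leq_card; rewrite pureD // leqNgt ltGd.
have setU h : h \notin G -> (mnm_set G + U_(h) *+ 1)%MM = mnm_set (h |: G).
  move=> hG; apply/mnmP => j.
  rewrite mnmDE mulmnE muln1 mnm1E !mnmE !inE eq_sym.
  by case: eqP => [->|]; rewrite ?(negPf hG) // addn0.
have [Gd|nGd] := eqVneq #|G|.+1 d; first exact: lee_ridge.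
have lee0 h : h \notin G -> lee (mnm_set G + U_(h) *+ 1)%MM = 0.
  move=> hG; rewrite setU //.
  have chG : #|h |: G| = #|G|.+1 by rewrite cardsU1 hG.
  apply: IH; rewrite chG; last by rewrite ltn_neqAle nGd.
  by rewrite -ltnS (leq_trans _ leGm) // ltnS ltn_sub2l.
have := @lee_trade idfun 1 F u (mnm_set G) (fun c => esym (expr1 c)) FD uF.
rewrite lee0 // big1 => [|h hF]; last first.
  by rewrite lee0 ?mulr0 //; apply: contra hF; apply: (subsetP sGF).
by move/esym/eqP; rewrite subr0 mulf_eq0 (negPf (coordD FD uF)) => /eqP.
Qed.

(** For the localized degree to kill the products with the parameters in degree
    [d], it has to vanish in degree [d - 1]; lower degrees enter through the
    trades. *)
Lemma lee_small E : (mdeg E < d)%N -> lee E = 0.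
Proof.
have [m] := ubnP (mdeg E); elim: m E => // m IH E.
elim/(@support_ind _ Delta 1): E => // [E ED _ _|E ED E1 _ ltEd|].
- exact: lee_nonface.
- rewrite (mnm_set_supp E1) lee_sqfree_small //.
  by rewrite -mdeg_set -mnm_set_supp.
move=> E F u FD _ uF IHh; rewrite mdegD mdegMn mdeg1 addn1 ltnS => ltm ltd.
rewrite (@lee_trade idfun _ F) //.
rewrite IH ?ltm ?(ltn_trans _ ltd) // mulr0 sub0r big1 ?oppr0 // => h hF.
by rewrite IHh ?mulr0 // mdegD mdegMn mdeg1 addn1.
Qed.

End Vanishing.
End Lee.

(** * Differential equation and Frobenius descent *)

Section LeeDerivatives.
Variables (d n : nat) (Delta : {set {set 'I_n}}) (eps : {set 'I_n} -> bool).
Variables (K : fieldType) (a : 'I_d -> 'I_n -> K) (v : 'I_d -> K).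
Variables (Da : 'I_d -> 'I_n -> K -> K) (Dv : 'I_d -> K -> K).
Implicit Types (E : 'X_{1..n}) (F G : {set 'I_n}).

Local Notation x F := (cone_coord a F v).
Local Notation lee := (lee Delta eps a v).

Hypothesis complexD : simplicial_complex Delta.
Hypothesis pureD : forall F, F \in facets Delta -> #|F| = d.
Hypothesis detD : forall F, F \in facets Delta -> \det (colmx a F) != 0.
Hypothesis coordD : forall F u, F \in facets Delta -> u \in F -> x F u != 0.

Hypothesis dDa : forall i j, derivation (Da i j).
Hypothesis dDv : forall i, derivation (Dv i).
Hypothesis Da_a : forall i j i' j',
  Da i j (a i' j') = ((i' == i) && (j' == j))%:R.
Hypothesis Da_v : forall i j l, Da i j (v l) = 0.
Hypothesis Dv_a : forall i i' j, Dv i (a i' j) = 0.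
Hypothesis Dv_v : forall i l, Dv i (v l) = (l == i)%:R.
Hypothesis Dav : forall i j l z, Da i j (Dv l z) = Dv l (Da i j z).

Lemma Dv_cone_coord i F u : F \in facets Delta ->
  Dv i (x F u) = dual_form a F u i.
Proof.
move=> FD; have cF := pureD FD; have dF := detD FD.
rewrite -[LHS]/((Dv i \o x F) u).
rewrite (cone_coord_uniq (v := fun l => (l == i)%:R) cF dF).
- rewrite /cone_coord (bigD1 i) //= eqxx mulr1 big1 ?addr0 // => l li.
  by rewrite (negPf li) mulr0.
- by move=> j jF /=; rewrite cone_coord_out // (der0 (dDv i)).
move=> l; rewrite -Dv_v -[v l in RHS](cone_coordE cF dF) (der_sum (dDv i)).
by apply: eq_bigr => j _; rewrite (derZ0 (dDv i)) // Dv_a.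
Qed.

(** Moving the column of [j] moves the solution of the linear system as moving
    [v] backwards does. *)
Lemma Da_cone_coord i j F u : F \in facets Delta ->
  Da i j (x F u) = - (x F j * Dv i (x F u)).
Proof.
move=> FD; have cF := pureD FD; have dF := detD FD.
rewrite Dv_cone_coord // -[LHS]/((Da i j \o x F) u).
rewrite (cone_coord_uniq (v := fun l => - (x F j * (l == i)%:R)) cF dF).
- set y := x F j.
  rewrite /cone_coord (bigD1 i) //= eqxx mulr1 big1 ?addr0 => [|l li].
    by rewrite mulrN mulrC.
  by rewrite (negPf li) mulr0 oppr0 mulr0.
- by move=> h hF /=; rewrite cone_coord_out // (der0 (dDa i j)).
move=> l; apply/eqP; rewrite -addr_eq0; apply/eqP.
transitivity (Da i j (v l)); last exact: Da_v.
rewrite -[in RHS](cone_coordE cF dF v l) (der_sum (dDa i j)).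
under [RHS]eq_bigr do rewrite (derM (dDa i j)).
rewrite big_split /= [RHS]addrC; congr (_ + _).
rewrite (bigD1 j) //= Da_a eqxx andbT mulrC big1 ?addr0 // => h hj.
by rewrite Da_a (negPf hj) andbF mul0r.
Qed.

Lemma Da_det i j F : F \in facets Delta ->
  Da i j (\det (colmx a F)) = \det (colmx a F) * dual_form a F j i.
Proof.
move=> FD; have cF := pureD FD; have dF := detD FD.
have DaM h (m i' : 'I_d) : h \in F -> index h (enum F) = m ->
    Da i j (colmx a F i' m) = ((i' == i) && (h == j))%:R.
  by move=> hF hm; rewrite (colmxE a i' hF hm) Da_a.
have [jF|jF] := boolP (j \in F); last first.
  rewrite dual_form_out // mulr0 (der_det0 (dDa i j)) // => i' m.
  have [h hF [hm _]] := enum_card_nth m cF.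
  rewrite (DaM h) //; have [hj|_] := eqVneq h j; last by rewrite andbF.
  by rewrite -hj hF in jF.
have [m jm ->] := dual_form_in a cF jF.
rewrite (der_det_entry (dDa i j) (j := m) (i := i)); last first.
  move=> i' m'; have [h hF [hm Eh]] := enum_card_nth m' cF.
  by rewrite (DaM h) // [h == j]eq_sym -Eh jm.
have uF : colmx a F \in unitmx by rewrite unitmxE unitfE.
by rewrite /invmx uF !mxE mulVKf.
Qed.

(** The derivative of the extra factor [x F j] in [v] accounts for that of
    [1 / [F]] in the column of [j]. *)
Lemma lee_der i j E : Da i j (lee E) = - Dv i (lee (E + U_(j))%MM).
Proof.
rewrite /lee (der_sum (dDa i j)) (der_sum (dDv i)) -sumrN.
apply: eq_bigr => F FD.
(* The elements h of the field with this property are closed under products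
   and inverses. *)
pose Q h := Da i j h = - (x F j * Dv i h).
have QM h1 h2 : Q h1 -> Q h2 -> Q (h1 * h2).
  by rewrite /Q (derM (dDa i j)) (derM (dDv i)) => -> ->; ring.
have QV h : Q h -> Q h^-1.
  by rewrite /Q (derV (dDa i j)) (derV (dDv i)) => ->; ring.
have Q1 : Q 1 by rewrite /Q (der1 (dDa i j)) (der1 (dDv i)) mulr0 oppr0.
have Qx u : Q (x F u) by apply: Da_cone_coord.
have QX h m : Q h -> Q (h ^+ m).
  by move=> Qh; elim: m => [|m IH]; rewrite ?expr0 // exprS; apply: QM.
set h := \prod_l _ / _.
have Qh : Q h.
  apply: (QM); first by apply: (big_ind Q Q1 QM) => u _; apply: QX.
  by apply: QV; apply: (big_ind Q Q1 QM).
rewrite -[U_(j)%MM]mulm1n prod_cone_coord_add expr1.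
rewrite -[X in _ = - Dv i (_ * X)]mulrA -/h.
have Dv_det : Dv i (\det (colmx a F)) = 0.
  apply: (der_det0 (dDv i)) => i' m.
  have [l lF [lm _]] := enum_card_nth m (pureD FD).
  by rewrite (colmxE a i' lF lm).
have Dv_c : Dv i ((-1) ^+ eps F / \det (colmx a F)) = 0.
  rewrite (derZ0 (dDv i)) ?(der_sign (dDv i)) // (derV (dDv i)) Dv_det.
  by rewrite oppr0 mul0r mulr0.
rewrite (derZ0 (dDv i)) // (derM (dDv i)) Dv_cone_coord //.
rewrite -mulrA (derZ0 (dDa i j)) ?(der_sign (dDa i j)) // (derM (dDa i j)).
rewrite Qh (derV (dDa i j)) Da_det //.
by have := detD FD => dF; field.
Qed.

(** The exponent of the monomial that the derivations of [w] bring in when they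
    are moved to the variables [v]. *)
Definition word_weight (w : seq ('I_d * 'I_n)) : 'X_{1..n} :=
  (\sum_(t <- w) U_(t.2))%MM.

Lemma word_weight_nil : word_weight [::] = 0%MM.
Proof. by rewrite /word_weight big_nil. Qed.

Lemma word_weight_cat w1 w2 :
  word_weight (w1 ++ w2) = (word_weight w1 + word_weight w2)%MM.
Proof. by rewrite /word_weight big_cat. Qed.

Lemma word_weight_nseq q t : word_weight (nseq q t) = (U_(t.2) *+ q)%MM.
Proof.
elim: q => [|q IH] /=; first by rewrite word_weight_nil mulm0n.
by rewrite mulmS -IH /word_weight big_cons.
Qed.

Local Notation Daw := (foldr (fun t => Da t.1 t.2)).

(** Moving a derivation inside reverses the order of the word. *)
Lemma lee_word w E :
  Daw (lee E) w = (-1) ^+ size w *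
    foldr Dv (lee (E + word_weight w)%MM) (rev (map fst w)).
Proof.
elim: w E => [|[i j] w IH] E; first by rewrite /word_weight big_nil addm0 mul1r.
rewrite /= IH (derZ0 (dDa i j)) ?(der_sign (dDa i j)) // rev_cons foldr_rcons.
have -> z s : Da i j (foldr Dv z s) = foldr Dv (Da i j z) s.
  by elim: s => //= l s <-.
rewrite lee_der -addmA /word_weight big_cons /= [(U_(j) + _)%MM]addmC.
by rewrite (foldr_derN dDv) exprS mulN1r mulrN mulNr.
Qed.

Section Vanishing.
Variables (k : fieldType) (f : {rmorphism k -> K}).
Hypothesis orD : orientation k Delta eps.

Let leeS := lee_small complexD pureD detD coordD f orD.

(** The value of [lee] is a polynomial in [v] of degree [mdeg E - d]. The
    vanishing of its higher derivatives is obtained without that fact: a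
    derivative in [v] is one in a coefficient, of a monomial of lower degree. *)
Lemma foldr_lee_small w E : (mdeg E < d + size w)%N ->
  foldr Dv (lee E) w = 0.
Proof.
elim/last_ind: w E => [|w i IH] E; first by rewrite addn0; apply: leeS.
rewrite size_rcons foldr_rcons addnS ltnS => leE.
have [->|] := eqVneq E 0%MM.
  rewrite leeS ?mdeg0 ?(leq_ltn_trans _ (ltn_ord i)) // (der0 (dDv i)).
  exact: foldr_der0.
rewrite -mdeg_eq0 mdegE sum_nat_eq0 negb_forall => /existsP[j].
rewrite -lt0n /= => Ej.
have EE : E = (E - U_(j) + U_(j))%MM by rewrite submK // lep1mP -lt0n.
have ltE : (mdeg (E - U_(j))%MM < d + size w)%N.
  by move: leE; rewrite {1}EE mdegD mdeg1 addn1.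
rewrite {1}EE -[Dv i _]opprK -lee_der (foldr_derN dDv).
have <- z s : Da i j (foldr Dv z s) = foldr Dv (Da i j z) s.
  by elim: s => //= l s <-.
by rewrite IH // (der0 (dDa i j)) oppr0.
Qed.

Section Frobenius.
Variable p : nat.
Hypothesis charK : p \in [pchar K].

Let p_pr : prime p := pcharf_prime charK.
Let p_gt0 : (0 < p)%N := prime_gt0 p_pr.

(** The word of [p - 1] derivations in each variable, row by row. *)
Definition full_word : seq 'I_d := \big[cat/[::]]_(i < d) nseq p.-1 i.

Lemma size_full_word : size full_word = (d * p.-1)%N.
Proof.
rewrite /full_word (big_morph size (@size_cat _) (erefl : size [::] = 0%N)).
by under eq_bigr do rewrite size_nseq; rewrite sum_nat_const card_ord.
Qed.

Lemma fact_predp : p.-1`!%:R = -1 :> K.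
Proof.
apply/eqP; rewrite -addr_eq0 natr1 -(dvdn_pcharf charK).
by rewrite -Wilson ?prime_gt1.
Qed.

Lemma sign_full_word : (-1) ^+ (d * p.-1) = 1 :> K.
Proof.
rewrite mulnC exprM; suff -> : (-1) ^+ p.-1 = 1 :> K by rewrite expr1n.
apply: (@mulfI _ (-1)); first by rewrite oppr_eq0 oner_eq0.
by rewrite -exprS prednK // mulr1 -(pFrobenius_autE charK) rmorphN rmorph1.
Qed.

Definition lee_root E : K :=
  if [forall j, p %| E j]%N then lee [multinom (E j %/ p)%N | j < n] else 0.

Let Psi E := foldr Dv (lee E) (rev full_word).

(** The word that differentiates [p - 1] times in each diagonal entry of the
    matrix of [F] moves the value at the indicator of [F], which is
    [eps_F / [F]], to the left-hand side. *)
Lemma lee_frobenius_facet F : F \in facets Delta ->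
  Psi (mnm_set F *+ p)%MM = (-1) ^+ d * lee (mnm_set F) ^+ p.
Proof.
move=> FD; have cF := pureD FD; have dF := detD FD.
have lee1 := lee_facet eps pureD coordD FD.
have /fin_all_exists[t tP] : forall m : 'I_d, exists j, j \in F /\
    index j (enum F) = m.
  by move=> m; have [j jF [jm _]] := enum_card_nth m cF; exists j.
pose w := \big[cat/[::]]_(m < d) nseq p.-1 (m, t m).
have fw : map fst w = full_word.
  rewrite /w /full_word.
  rewrite (big_morph (map fst) (@map_cat _ _ _) (erefl : map fst [::] = [::])).
  by apply: eq_bigr => m _; rewrite map_nseq.
have ww : word_weight w = (mnm_set F *+ p.-1)%MM.
  rewrite /w (big_morph word_weight word_weight_cat word_weight_nil).
  under eq_bigr do rewrite word_weight_nseq /=.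
  apply/mnmP => j; rewrite mnm_sumE mulmnE mnmE.
  under eq_bigr do rewrite mulmnE mnm1E.
  rewrite -big_distrl; congr (_ * _)%N; have [jF|jF] := boolP (j \in F).
    have lt_j : (index j (enum F) < d)%N.
      by rewrite -[X in (_ < X)%N]cF cardE index_mem mem_enum.
    rewrite (bigD1 (Ordinal lt_j)) //=.
    have [tF tj] := tP (Ordinal lt_j).
    have {tF tj}-> : t (Ordinal lt_j) = j.
      by apply: index_inj tj; rewrite ?mem_enum.
    rewrite eqxx big1 // => m mj.
    case: eqP => // tm; case/eqP: mj; apply: val_inj => /=.
    by have [_ <-] := tP m; rewrite tm.
  rewrite big1 // => m _; case: eqP => // tm.
  by have [] := tP m; rewrite tm (negPf jF).
have mulmS' : (mnm_set F + mnm_set F *+ p.-1 = mnm_set F *+ p)%MM.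
  by rewrite -mulmS prednK.
have size_w : size w = (d * p.-1)%N.
  by rewrite -(size_map fst) fw size_full_word.
have := lee_word w (mnm_set F).
rewrite fw ww mulmS' size_w sign_full_word mul1r -/(Psi _) => <-; rewrite lee1.
set D := fun t : 'I_d * 'I_n => Da t.1 t.2.
have dD u : derivation (D u) by apply: dDa.
have lee1E : (-1) ^+ eps F / \det (colmx a F)
    = (-1) ^+ eps F * ((\det (colmx a F))^-1) ^+ p * \det (colmx a F) ^+ p.-1.
  rewrite -mulrA; congr (_ * _).
  by rewrite -[in RHS](prednK p_gt0) exprS -mulrA -exprMn mulVf // expr1n mulr1.
rewrite {1}lee1E (diag_der_det dD).
- rewrite fact_predp exprMn; congr (_ * (_ * _)).
  by rewrite -exprM mulnC exprM -(pFrobenius_autE charK) rmorphN rmorph1.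
- move=> l; rewrite (derM (dD _)) (der_sign (dD _)) mul0r add0r.
  by rewrite (der_pchar (dD _) _ charK) mulr0.
move=> l i m; have [tF tl] := tP l.
have [j jF [jm Ej]] := enum_card_nth m cF.
rewrite (colmxE a i jF jm) /D Da_a; congr (nat_of_bool (_ && _))%:R => /=.
by rewrite [j == _]eq_sym -Ej tl.
Qed.

(** Both sides obey the trades by [p] units: the left one because [p]th powers
    are constants, the right one because Frobenius is additive. *)
Lemma lee_frobenius E : mdeg E = (d * p)%N ->
  Psi E = (-1) ^+ d * lee_root E ^+ p.
Proof.
elim/(@support_ind _ Delta p): E => [|E ED _|E ED leEp degE|E F u FD _ uF IH].
- exact: p_gt0.
- rewrite /Psi lee_nonface // foldr_der0 // /lee_root.
  case: ifP => [/forallP pE|_].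
    rewrite lee_nonface ?expr0n ?(gtn_eqF p_gt0) ?mulr0 //.
    suff -> : mnm_supp [multinom (E j %/ p)%N | j < n] = mnm_supp E by [].
    by apply/setP => j; rewrite !inE mnmE -{2}(divnK (pE j)) muln_eq0 negb_or
      [p == _]gtn_eqF // andbT.
  by rewrite expr0n gtn_eqF // mulr0.
- pose S := mnm_supp E.
  have [F maxF sSF] := @maxset_exists _ (fun G => G \in Delta) _ ED.
  have FD : F \in facets Delta by rewrite inE.
  have cF := pureD FD.
  have sumE : \sum_(j in F) E j = (\sum_(j in F) p)%N.
    rewrite sum_nat_const cF -degE mdegE [RHS](bigID (mem F)) /=.
    rewrite [X in (_ + X)%N]big1 ?addn0 // => j jF; apply/eqP.
    by have := contra (subsetP sSF j) jF; rewrite inE negbK.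
  (* The exponents are at most [p] on the [d] vertices of [F], and add up to
     [d * p]. *)
  have EE : E = (mnm_set F *+ p)%MM.
    apply/mnmP => j; rewrite mulmnE mnmE; have [jF|jF] := boolP (j \in F).
      apply/eqP; rewrite mul1n eqn_leq leEp leqNgt; apply/negP => ltE.
      suff : (\sum_(j in F) E j < \sum_(j in F) p)%N by rewrite sumE ltnn.
      rewrite (bigD1 j) //= [X in (_ < X)%N](bigD1 j) //= -addSn leq_add //.
      by apply: leq_sum.
    rewrite mul0n; apply/eqP.
    by have := contra (subsetP sSF j) jF; rewrite inE negbK.
  rewrite {1}EE lee_frobenius_facet // /lee_root ifT; last first.
    by apply/forallP => j; rewrite EE mulmnE dvdn_mull.
  congr (_ * lee _ ^+ _); apply/mnmP => j.
  by rewrite [RHS]mnmE EE mulmnE mulnK.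
rewrite mdegD mdegMn mdeg1 mul1n => degE.
pose phi : {rmorphism K -> K} := pFrobenius_aut charK.
have phiE c : phi c = c ^+ p by exact: pFrobenius_autE.
have phi0 c l : Dv l (phi c) = 0 by rewrite phiE (der_pchar (dDv l) _ charK).
pose lam h := \sum_i dual_form a F u i * a i h.
have -> : Psi (E + U_(u) *+ p)%MM
    = - \sum_(h | h \notin F) phi (lam h) * Psi (E + U_(h) *+ p)%MM.
  rewrite /Psi (lee_trade eps v pureD detD E phiE FD uF).
  rewrite (foldr_derD dDv) (foldr_derN dDv) (foldr_derZ dDv) //.
  rewrite foldr_lee_small ?mulr0 ?add0r; last first.
    rewrite size_rev size_full_word -mulnS prednK // -degE -addn1 leq_add2l.
    exact: p_gt0.
  rewrite (foldr_der_sum dDv); congr (- _); apply: eq_bigr => h _.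
  by rewrite (foldr_derZ dDv).
under eq_bigr => h hF do rewrite IH // ?mdegD ?mdegMn ?mdeg1 ?mul1n // mulrCA.
rewrite -big_distrr -mulrN /=; congr (_ * _).
have dvd_add h :
    [forall j, p %| (E + U_(h) *+ p)%MM j]%N = [forall j, p %| E j]%N.
  by apply: eq_forallb => j; rewrite mnmDE mulmnE dvdn_addl // dvdn_mull.
rewrite /lee_root dvd_add; under eq_bigr do rewrite dvd_add.
case: ifP => [/forallP pE|_]; last first.
  rewrite expr0n gtn_eqF // big1 ?oppr0 // => h _.
  by rewrite mulr0.
pose M : 'X_{1..n} := [multinom (E j %/ p)%N | j < n].
have rootE h : [multinom ((E + U_(h) *+ p)%MM j %/ p)%N | j < n]
    = (M + U_(h) *+ 1)%MM.
  apply/mnmP => j; rewrite mnmE !mnmDE mnmE !mulmnE muln1.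
  by rewrite divnDr ?dvdn_mull // mulnK.
have EM : E = (M *+ p)%MM by apply/mnmP => j; rewrite mulmnE mnmE divnK.
have ltM : (mdeg M < d)%N.
  rewrite -(ltn_pmul2r p_gt0) -mdegMn -EM -degE -addn1 leq_add2l; exact: p_gt0.
rewrite rootE (lee_trade (phi := idfun) (q := 1) eps v pureD detD M _ FD uF) //.
rewrite leeS // mulr0 sub0r -phiE rmorphN rmorph_sum; congr (- _).
by apply: eq_bigr => h _; rewrite rootE -phiE -rmorphM.
Qed.

Lemma lee_word_root w E : map fst w = full_word -> mdeg E = d ->
  Daw (lee E) w = (-1) ^+ d * lee_root (E + word_weight w)%MM ^+ p.
Proof.
move=> wE degE; have sw : size w = (d * p.-1)%N.
  by rewrite -(size_map fst) wE size_full_word.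
rewrite lee_word wE sw sign_full_word mul1r -/(Psi _) lee_frobenius //.
rewrite mdegD degE.
rewrite /word_weight mdeg_sum; under eq_bigr do rewrite mdeg1.
by rewrite sum1_size sw -mulnS prednK.
Qed.

End Frobenius.
End Vanishing.
End LeeDerivatives.

(** * Derivations of polynomials and fractions *)

Section PolynomialDerivations.
Variables (m : nat) (A : comNzRingType).

Lemma mderiv_derivation (l : 'I_m) :
  derivation (mderiv l : {mpoly A[m]} -> {mpoly A[m]}).
Proof. by split=> [x y|x y]; [apply: mderivD | apply: mderivM]. Qed.

Variables (delta : A -> A) (ddelta : derivation delta).

Lemma mcoeff_map_der (p : {mpoly A[m]}) e :
  (map_mpoly delta p)@_e = delta p@_e :> A.
Proof.
have dB : zmod_morphism delta.
  by move=> x y; rewrite (derD ddelta) (derN ddelta).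
pose del : {additive A -> A} :=
  HB.pack delta (GRing.isZmodMorphism.Build _ _ delta dB).
exact: (@mcoeff_map_mpoly m A A del).
Qed.

Lemma map_mpoly_derivation :
  derivation (map_mpoly delta : {mpoly A[m]} -> {mpoly A[m]}).
Proof.
split=> x y; apply/mpolyP => e.
  by rewrite mcoeffD !mcoeff_map_der mcoeffD (derD ddelta).
rewrite mcoeffD mcoeff_map_der !mcoeffM (der_sum ddelta) -big_split.
apply: eq_bigr => i _ /=; rewrite (derM ddelta).
by rewrite -!mcoeff_map_der.
Qed.

Lemma map_mpoly_mderiv (l : 'I_m) (p : {mpoly A[m]}) :
  map_mpoly delta (mderiv l p) = mderiv l (map_mpoly delta p).
Proof.
apply/mpolyP => e; rewrite mcoeff_map_der !mcoeff_deriv mcoeff_map_der.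
elim: (e l).+1 => [|b IH]; first by rewrite !mulr0n (der0 ddelta).
by rewrite !mulrS (derD ddelta) IH.
Qed.

Lemma map_derC c : map_mpoly delta c%:MP_[m] = (delta c)%:MP_[m].
Proof.
apply/mpolyP => e; rewrite mcoeff_map_der !mcoeffC.
by case: eqP => _; rewrite ?mulr1 // !mulr0 (der0 ddelta).
Qed.

Lemma map_derX e : map_mpoly delta 'X_[e] = 0 :> {mpoly A[m]}.
Proof.
apply/mpolyP => e'; rewrite mcoeff_map_der mcoeffX mcoeff0.
exact: (der_nat ddelta).
Qed.

End PolynomialDerivations.

Lemma quotient_ruleD (K : fieldType) (a b c e a' b' c' e' : K) :
  b != 0 -> e != 0 ->
  ((a' * e + a * e' + (c' * b + c * b')) * (b * e)
     - (a * e + c * b) * (b' * e + b * e')) / (b * e) ^+ 2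
  = (a' * b - a * b') / b ^+ 2 + (c' * e - c * e') / e ^+ 2.
Proof. by move=> b0 e0; field; rewrite b0 e0. Qed.

Lemma quotient_ruleM (K : fieldType) (a b c e a' b' c' e' : K) :
  b != 0 -> e != 0 ->
  ((a' * c + a * c') * (b * e) - a * c * (b' * e + b * e')) / (b * e) ^+ 2
  = (a' * b - a * b') / b ^+ 2 * (c / e)
    + a / b * ((c' * e - c * e') / e ^+ 2).
Proof. by move=> b0 e0; field; rewrite b0 e0. Qed.

(** The commutator of two derivations is a derivation, so it vanishes on a
    quotient when it vanishes on the numerator and the denominator. *)
Lemma der_comm_factor (K : fieldType) (D1 D2 : K -> K) x w :
  derivation D1 -> derivation D2 -> w != 0 ->
  D1 (D2 (x * w)) = D2 (D1 (x * w)) -> D1 (D2 w) = D2 (D1 w) ->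
  D1 (D2 x) = D2 (D1 x).
Proof.
move=> d1 d2 w0 + Ew; rewrite !(derM d1, derM d2, derD d1, derD d2) Ew => E.
apply: (mulIf w0); apply/eqP; rewrite -subr_eq0; apply/eqP.
by move/eqP: E; rewrite -subr_eq0 => /eqP <-; ring.
Qed.

Section FractionDerivations.
Variable A : idomainType.

Lemma fraction_quotient (x : {fraction A}) :
  exists u v : A, v != 0 /\ x = tofrac u / tofrac v.
Proof.
set a := (frac (repr x)).1; set b := (frac (repr x)).2.
have b0 : b != 0 by apply: denom_ratioP.
exists a, b; split=> //; apply: (canRL (mulfK _)); first by rewrite tofrac_eq0.
rewrite -[x]reprK; unlock tofrac; rewrite -[LHS]FracField.pi_mul.
apply/eqP; rewrite FracField.equivf_def /FracField.mulf.
by rewrite !numden_Ratio ?oner_neq0 ?mulr1 ?mulf_neq0 ?denom_ratioP // mulrC.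
Qed.

Lemma frac_deriv_derivation (der : A -> A) :
  derivation der -> derivation (frac_deriv der).
Proof.
move=> dd; have E := frac_derivE _ (derM dd).
split=> x y; have [a [b [b0 ->]]] := fraction_quotient x;
  have [c [e [e0 ->]]] := fraction_quotient y;
  have tb : tofrac b != 0 by rewrite tofrac_eq0.
  have te : tofrac e != 0 by rewrite tofrac_eq0.
  rewrite addf_div // -!tofracM -tofracD !E ?mulf_neq0 //.
  rewrite (derD dd) !(derM dd) !(tofracB, tofracD, tofracM, tofracXn).
  exact: quotient_ruleD.
have te : tofrac e != 0 by rewrite tofrac_eq0.
rewrite mulf_div -!tofracM !E ?mulf_neq0 //.
rewrite !(derM dd) !(tofracB, tofracD, tofracM, tofracXn).
exact: quotient_ruleM.
Qed.

Lemma frac_deriv_tofrac (der : A -> A) u :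
  derivation der -> frac_deriv der (tofrac u) = tofrac (der u).
Proof.
move=> dd; rewrite -[tofrac u]divr1 -tofrac1 frac_derivE ?oner_neq0 //.
  by rewrite (der1 dd) mulr0 subr0 mulr1 expr1n divr1.
exact: derM dd.
Qed.

Lemma frac_deriv_comm (der1 der2 : A -> A) x :
  derivation der1 -> derivation der2 ->
  (forall u, der1 (der2 u) = der2 (der1 u)) ->
  frac_deriv der1 (frac_deriv der2 x) = frac_deriv der2 (frac_deriv der1 x).
Proof.
move=> d1 d2 d12; have [u [w [w0 xE]]] := fraction_quotient x.
have tw : tofrac w != 0 by rewrite tofrac_eq0.
apply: (der_comm_factor (w := tofrac w)) => //.
- exact: frac_deriv_derivation.
- exact: frac_deriv_derivation.
- by rewrite xE divfK // !frac_deriv_tofrac // d12.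
by rewrite !frac_deriv_tofrac // d12.
Qed.

End FractionDerivations.

(** * The field of generic coefficients *)

Section GenericMatrix.
Variables (k : fieldType) (d n : nat).
Local Notation K := (ratfield k d n).
Local Notation a := (@avar k d n).
Implicit Types (F : {set 'I_n}).

Lemma pderiv_derivation i j : derivation (@pderiv k d n i j).
Proof. exact/frac_deriv_derivation/mderiv_derivation. Qed.

Lemma pderiv_avar i j i' j' :
  pderiv i j (a i' j') = ((i' == i) && (j' == j))%:R.
Proof.
rewrite /pderiv /avar frac_deriv_tofrac; last exact: mderiv_derivation.
rewrite mderivX mnm1E (_ : mxvec_index i' j' == mxvec_index i j
  = ((i' == i) && (j' == j))); last first.
  by rewrite (inj_eq (@cast_ord_inj _ _ _)) (inj_eq enum_rank_inj).
case: (_ && _) / andP => [[/eqP-> /eqP->]|_]; last by rewrite scale0r tofrac0.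
rewrite scale1r (_ : (_ - _)%MM = 0%MM) ?mpolyX0 ?tofrac1 //.
by apply/mnmP => l; rewrite mnmBE subnn mnm0E.
Qed.

Lemma det_avar_neq0 F : #|F| = d -> \det (colmx a F) != 0.
Proof.
move=> cF.
pose M : 'M[{mpoly k[(d * n)%N]}]_d := \matrix_(i, m)
  [seq 'X_(mxvec_index i j) | j <- enum F]`_m.
have -> : colmx a F = map_mx (@tofrac (polydom k d n)) M.
  apply/matrixP => i m; have [j jF [jm _]] := enum_card_nth m cF.
  rewrite (colmxE a i jF jm) !mxE (nth_map j) -jm ?index_mem ?mem_enum //.
  by rewrite nth_index ?mem_enum.
rewrite det_map_mx tofrac_eq0; apply/eqP => M0.
(* At this point the columns of [F] form the identity matrix. *)
pose c : 'I_(d * n) -> k :=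
  mxvec (\matrix_(i < d, j < n) (index j (enum F) == i)%:R) 0.
have : \det (map_mx (meval c) M) = 0 by rewrite det_map_mx /= M0 rmorph0.
suff -> : map_mx (meval c) M = 1%:M by move/eqP; rewrite det1 oner_eq0.
apply/matrixP => i m; have [j jF [jm _]] := enum_card_nth m cF.
rewrite !mxE (nth_map j) -jm ?index_mem ?mem_enum // nth_index ?mem_enum //.
by rewrite mevalXU /c mxvecE mxE jm eq_sym.
Qed.

Local Notation Kv := {fraction {mpoly K[d]}}.

(** [K(v)] for a generic vector [v], as an extension of [K]. *)
Definition extend : K -> Kv := @tofrac {mpoly K[d]} \o @mpolyC d K.

HB.instance Definition _ := GRing.RMorphism.on extend.

Definition generic_vec (l : 'I_d) : Kv := tofrac ('X_l : {mpoly K[d]}).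

Definition ext_pderiv i j : Kv -> Kv :=
  frac_deriv (map_mpoly (@pderiv k d n i j) : {mpoly K[d]} -> {mpoly K[d]}).

Definition vec_deriv (l : 'I_d) : Kv -> Kv :=
  frac_deriv (mderiv l : {mpoly K[d]} -> {mpoly K[d]}).

Lemma ext_pderiv_derivation i j : derivation (ext_pderiv i j).
Proof.
exact/frac_deriv_derivation/map_mpoly_derivation/pderiv_derivation.
Qed.

Lemma vec_deriv_derivation l : derivation (vec_deriv l).
Proof. exact/frac_deriv_derivation/mderiv_derivation. Qed.

Lemma ext_pderiv_extend i j x :
  ext_pderiv i j (extend x) = extend (pderiv i j x).
Proof.
have dp := pderiv_derivation i j.
rewrite /ext_pderiv /extend /= frac_deriv_tofrac ?map_derC //.
exact: map_mpoly_derivation.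
Qed.

Lemma ext_pderiv_vec i j l : ext_pderiv i j (generic_vec l) = 0.
Proof.
have dp := pderiv_derivation i j.
rewrite /ext_pderiv frac_deriv_tofrac ?map_derX ?tofrac0 //.
exact: map_mpoly_derivation.
Qed.

Lemma vec_deriv_extend l x : vec_deriv l (extend x) = 0.
Proof.
rewrite /vec_deriv frac_deriv_tofrac ?mderivC ?tofrac0 //.
exact: mderiv_derivation.
Qed.

Lemma vec_deriv_vec l l' : vec_deriv l (generic_vec l') = (l' == l)%:R.
Proof.
rewrite /vec_deriv frac_deriv_tofrac; last exact: mderiv_derivation.
rewrite mderivX mnm1E; have [->|_] := eqVneq; last by rewrite scale0r tofrac0.
rewrite scale1r (_ : (_ - _)%MM = 0%MM) ?mpolyX0 ?tofrac1 //.
by apply/mnmP => b; rewrite mnmBE subnn mnm0E.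
Qed.

Lemma ext_pderiv_vec_deriv i j l z :
  ext_pderiv i j (vec_deriv l z) = vec_deriv l (ext_pderiv i j z).
Proof.
have dp := pderiv_derivation i j.
apply: frac_deriv_comm; first exact: map_mpoly_derivation.
  exact: mderiv_derivation.
by move=> u; apply: map_mpoly_mderiv.
Qed.

Definition ext_avar i j : Kv := extend (a i j).

Lemma colmx_extend F : #|F| = d ->
  colmx ext_avar F = map_mx extend (colmx a F).
Proof.
move=> cF; apply/matrixP => i m; have [j jF [jm _]] := enum_card_nth m cF.
by rewrite [RHS]mxE !(colmxE _ i jF jm).
Qed.

Lemma det_ext_avar F : #|F| = d ->
  \det (colmx ext_avar F) = extend (\det (colmx a F)).
Proof. by move=> cF; rewrite colmx_extend // det_map_mx. Qed.

Lemma det_ext_avar_neq0 F : #|F| = d -> \det (colmx ext_avar F) != 0.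
Proof. by move=> cF; rewrite det_ext_avar // fmorph_eq0 det_avar_neq0. Qed.

Lemma dual_form_extend F u i : #|F| = d ->
  dual_form ext_avar F u i = extend (dual_form a F u i).
Proof.
move=> cF; rewrite /dual_form rmorph_sum; apply: eq_bigr => m _.
by rewrite colmx_extend // -map_invmx mxE.
Qed.

Lemma cone_coord_neq0 F u : #|F| = d -> u \in F ->
  cone_coord ext_avar F generic_vec u != 0.
Proof.
move=> cF uF.
have -> : cone_coord ext_avar F generic_vec u
    = tofrac (\sum_i dual_form a F u i *: 'X_i : {mpoly K[d]}).
  rewrite /cone_coord rmorph_sum; apply: eq_bigr => i _.
  by rewrite dual_form_extend // -mul_mpolyC rmorphM.
have [i ui] := dual_form_neq0 cF (det_avar_neq0 cF) uF.
rewrite tofrac_eq0; apply/eqP => /(congr1 (mcoeff U_(i)%MM)) /eqP.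
rewrite mcoeff0 raddf_sum (bigD1 i) //= mcoeffZ mcoeffX eqxx mulr1 big1.
  by rewrite addr0 (negPf ui).
move=> l li; rewrite mcoeffZ mcoeffX.
case: eqP => [/mnmP/(_ l)|_]; last by rewrite mulr0.
by rewrite !mnm1E eqxx eq_sym (negPf li).
Qed.

Lemma foldr_ext_pderiv x w :
  foldr (fun t => ext_pderiv t.1 t.2) (extend x) w
  = extend (foldr (fun t => pderiv t.1 t.2) x w).
Proof. by elim: w => //= t w ->; rewrite ext_pderiv_extend. Qed.

End GenericMatrix.

(** * Comparison of degree maps *)

Section DegreeIsLee.
Variables (R : realType) (k : fieldType) (d n : nat).
Variables (Delta : {set {set 'I_n}}) (eps : {set 'I_n} -> bool).
Local Notation K := (ratfield k d n).
Variable deg : {mpoly K[n]} -> K.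
Hypothesis pmD : pseudomanifold R d Delta.
Hypothesis orD : orientation k Delta eps.
Hypothesis degD : degree_map Delta eps deg.
Implicit Types (E : 'X_{1..n}) (F G : {set 'I_n}).

Local Notation a := (@avar k d n).
Local Notation leeK := (lee Delta eps (@ext_avar k d n) (@generic_vec k d n)).

Let complexD := pm_complex pmD.
Let pureD := pm_pure pmD.

Let detD F : F \in facets Delta -> \det (colmx (@ext_avar k d n) F) != 0.
Proof. by move/pureD; apply: det_ext_avar_neq0. Qed.

Let coordD F u : F \in facets Delta -> u \in F ->
  cone_coord (@ext_avar k d n) F (@generic_vec k d n) u != 0.
Proof. by move/pureD; apply: cone_coord_neq0. Qed.

Let embed_k (c : k) := extend (tofrac (c%:MP : polydom k d n)).
Let embed_k_add : zmod_morphism embed_k.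
Proof. by move=> x y; rewrite /embed_k !rmorphB. Qed.
Let embed_k_mul : monoid_morphism embed_k.
Proof. by split=> [|x y]; rewrite /embed_k ?rmorph1 ?rmorphM. Qed.
Let emb : {rmorphism k -> {fraction {mpoly K[d]}}} :=
  HB.pack embed_k (GRing.isZmodMorphism.Build _ _ embed_k embed_k_add)
    (GRing.isMonoidMorphism.Build _ _ embed_k embed_k_mul).

Lemma homogX E : mdeg E = d -> 'X_[E] \is [in K[n], d.-homog].
Proof. by move=> degE; rewrite dhomogX; apply/eqP. Qed.

Lemma deg0 : deg 0 = 0.
Proof.
have := degree_linear degD 1 (dhomog0 _ _ d) (dhomog0 _ _ d).
by rewrite scale1r addr0 mul1r => /eqP; rewrite -subr_eq0 opprD addrA subrr
  sub0r oppr_eq0 => /eqP.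
Qed.

Lemma deg_sum (P : pred 'I_n) (c : 'I_n -> K) (m : 'I_n -> 'X_{1..n}) :
  (forall h, mdeg (m h) = d) ->
  deg (\sum_(h | P h) c h *: 'X_[m h]) = \sum_(h | P h) c h * deg 'X_[m h].
Proof.
move=> degm; pose rel (x : {mpoly K[n]}) y := x \is d.-homog /\ deg x = y.
suff [] : rel (\sum_(h | P h) c h *: 'X_[m h])
    (\sum_(h | P h) c h * deg 'X_[m h]) by [].
elim/big_rec2: _ => [|h y x _ [hx <-]].
  by split; [apply: dhomog0 | apply: deg0].
have hm : 'X_[m h] \is [in K[n], d.-homog] by exact: homogX.
by split; [rewrite dhomogD ?dhomogZ | rewrite (degree_linear degD)].
Qed.

Lemma sqfree_monE F : sqfree_mon k d F = 'X_[mnm_set F] :> {mpoly K[n]}.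
Proof.
rewrite /sqfree_mon -(big_morph (@mpolyX n K) (@mpolyXD n K) (@mpolyX0 n K)).
congr 'X_[_]; apply/mnmP => j.
rewrite mnm_sumE mnmE; under eq_bigr do rewrite mnm1E.
have [jF|jF] := boolP (j \in F).
  by rewrite (bigD1 j) //= eqxx big1 // => h /andP[_ /negPf->].
by rewrite big1 // => h hF; case: eqP => // hj; rewrite -hj hF in jF.
Qed.

Lemma deg_nonface E : mnm_supp E \notin Delta -> mdeg E = d -> deg 'X_[E] = 0.
Proof.
move=> ED degE; apply/(degree_ker degD); first exact: homogX.
exists (fun G => if G == mnm_supp E then 'X_[E - mnm_set G] else 0), (fun=> 0).
rewrite [X in _ + X]big1 ?addr0 => [|i _]; last by rewrite mul0r.
rewrite (bigD1 (mnm_supp E)) //= eqxx big1 ?addr0 => [|G /andP[_ /negPf->]].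
  rewrite sqfree_monE -mpolyXD submK //; apply/mnm_lepP => j.
  by rewrite mnmE inE; case: (E j).
by rewrite mul0r.
Qed.

(** The combination of the parameters with coefficients [dual_form a F u],
    multiplied by [x^E], is an element of the ideal. *)
Lemma deg_trade F u E : F \in facets Delta -> u \in F ->
  (mdeg E).+1 = d ->
  deg 'X_[E + U_(u) *+ 1] = - \sum_(h | h \notin F)
    (\sum_i dual_form a F u i * a i h) * deg 'X_[E + U_(h) *+ 1].
Proof.
move=> FD uF degE; have cF := pureD FD; have dF := det_avar_neq0 k cF.
pose c h := \sum_i dual_form a F u i * a i h.
have degU h : mdeg (E + U_(h) *+ 1)%MM = d by rewrite mdegD mdegMn mdeg1 addn1.
have : deg (\sum_h c h *: 'X_[E + U_(h) *+ 1]) = 0.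
  apply/(degree_ker degD).
    by apply: rpred_sum => h _; apply: dhomogZ; apply: homogX.
  exists (fun=> 0), (fun i => dual_form a F u i *: 'X_[E]).
  rewrite [X in X + _]big1 ?add0r => [|G _]; last by rewrite mul0r.
  under [RHS]eq_bigr do rewrite /mu big_distrr /=.
  rewrite exchange_big; apply: eq_bigr => h _ /=; rewrite scaler_suml.
  apply: eq_bigr => i _; rewrite -scalerAl -scalerAr scalerA.
  by rewrite mulm1n mpolyXD.
rewrite deg_sum // (bigID (mem F)) /= => /eqP; rewrite addr_eq0 => /eqP <-.
rewrite (bigD1 u) //= /c dual_formE // eqxx mul1r big1 ?addr0 //.
move=> h /andP[hF hu].
by rewrite dual_formE // (negPf hu) mul0r.
Qed.

(** Both functionals are determined by the same trades and by their common
    values at non-faces and at facets. *)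
Lemma extend_deg E : mdeg E = d -> extend (deg 'X_[E]) = leeK E.
Proof.
elim/(@support_ind _ Delta 1): E => // [E ED degE|E ED E1 degE|].
- by rewrite deg_nonface // rmorph0 (lee_nonface eps _ _ complexD pureD).
- pose F := mnm_supp E; have EF : E = mnm_set F by apply: mnm_set_supp.
  have cF : #|F| = d by rewrite -mdeg_set -EF.
  have [F' maxF' sF] := @maxset_exists _ (fun G => G \in Delta) _ ED.
  have F'D : F' \in facets Delta by rewrite inE.
  have FD : F \in facets Delta.
    suff -> : F = F' by [].
    by apply/eqP; rewrite eqEcard sF (pureD F'D) cF leqnn.
  rewrite EF (lee_facet eps pureD coordD FD) -sqfree_monE.
  rewrite (degree_facet degD) // det_ext_avar // fmorph_div rmorph_sign.
  by [].
move=> E F u FD _ uF IH; rewrite mdegD mdegMn mdeg1 addn1 => degE.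
have cF := pureD FD.
rewrite (deg_trade FD uF degE).
rewrite (lee_trade (phi := idfun) eps _ pureD detD E _ FD uF) //.
rewrite (lee_small complexD pureD detD coordD emb orD) ?mulr0 ?sub0r;
  last by rewrite -degE.
rewrite rmorphN rmorph_sum; congr (- _); apply: eq_bigr => h hF /=.
rewrite rmorphM [X in _ * X]IH // ?mdegD ?mdegMn ?mdeg1 ?addn1 //.
congr (_ * _); rewrite rmorph_sum; apply: eq_bigr => i _.
by rewrite rmorphM dual_form_extend.
Qed.

Lemma deg_word_root p w E : p \in [pchar k] ->
  map fst w = full_word d p -> mdeg E = d ->
  foldr (fun t => pderiv t.1 t.2) (deg 'X_[E]) w
  = (-1) ^+ d * deg (mon_root _ p (E + word_weight w)%MM) ^+ p.
Proof.
move=> charp wE degE; have p0 := prime_gt0 (pcharf_prime charp).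
have charKv : p \in [pchar {fraction {mpoly K[d]}}] := rmorph_pchar emb charp.
apply: (fmorph_inj (@extend k d n)).
rewrite -[LHS]foldr_ext_pderiv extend_deg //.
have Da_a i j i' j' : ext_pderiv i j (@ext_avar k d n i' j')
    = ((i' == i) && (j' == j))%:R.
  by rewrite ext_pderiv_extend pderiv_avar rmorph_nat.
have Dv_a l i j : vec_deriv l (@ext_avar k d n i j) = 0.
  exact: vec_deriv_extend.
rewrite (lee_word_root complexD pureD detD coordD (@ext_pderiv_derivation k d n)
  (@vec_deriv_derivation k d n) Da_a (@ext_pderiv_vec k d n) Dv_a
  (@vec_deriv_vec k d n) (@ext_pderiv_vec_deriv k d n) emb orD charKv wE degE).
rewrite rmorphM rmorph_sign rmorphXn; congr (_ * _ ^+ _).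
rewrite /lee_root /mon_root; case: ifP => [/forallP pE|_].
  rewrite [RHS]extend_deg //; apply/eqP; rewrite -(eqn_pmul2r p0) -mdegMn.
  rewrite (_ : (_ *+ p)%MM = (E + word_weight w)%MM); last first.
    by apply/mnmP => j; rewrite mulmnE mnmE divnK.
  rewrite mdegD degE mdeg_sum; under eq_bigr do rewrite mdeg1.
  by rewrite sum1_size -(size_map fst) wE size_full_word -mulnS prednK.
by rewrite deg0 rmorph0.
Qed.

End DegreeIsLee.

(** * The operator of an exponent matrix *)

(** The order in which [pderiv_mx] applies the partial derivatives. *)
Definition mx_word d n (I : 'M[nat]_(d, n)) : seq ('I_d * 'I_n) :=
  \big[cat/[::]]_(i < d) \big[cat/[::]]_(j < n) nseq (I i j) (i, j).

Lemma pderiv_mxE (k : fieldType) d n (I : 'M[nat]_(d, n)) (z : ratfield k d n) :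
  pderiv_mx I z = foldr (fun t => pderiv t.1 t.2) z (mx_word I).
Proof.
rewrite /pderiv_mx /mx_word; elim: (index_enum _) z => [|i r IH] z.
  by rewrite !big_nil.
rewrite !big_cons /= foldr_cat -IH.
elim: (index_enum _) (_ z) => [|j s IHs] y; first by rewrite !big_nil.
rewrite !big_cons /= foldr_cat -IHs.
by elim: (I i j) => //= b <-.
Qed.

Lemma map_fst_mx_word p d n (I : 'M[nat]_(d, n)) :
  (forall i, (\sum_j I i j)%N = p.-1) -> map fst (mx_word I) = full_word d p.
Proof.
move=> sumI; rewrite /mx_word /full_word.
rewrite (big_morph (map fst) (@map_cat _ _ _) (erefl : map fst [::] = [::])).
apply: eq_bigr => i _; rewrite -(sumI i).
elim: (index_enum _) => [|j s IH]; first by rewrite !big_nil.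
by rewrite !big_cons map_cat IH nseqD map_nseq.
Qed.

Lemma word_weight_mx_word d n (I : 'M[nat]_(d, n)) :
  word_weight (mx_word I) = mx_expo I.
Proof.
apply/mnmP => j; rewrite mnmE /mx_word.
rewrite (big_morph _ (@word_weight_cat d n) (@word_weight_nil d n)) mnm_sumE.
apply: eq_bigr => i _.
rewrite (big_morph _ (@word_weight_cat d n) (@word_weight_nil d n)) mnm_sumE.
under eq_bigr do rewrite word_weight_nseq mulmnE mnm1E.
rewrite (bigD1 j) //= eqxx mul1n big1 ?addn0 // => h /negPf ->.
by rewrite mul0n.
Qed.


Theorem theorem1p2 (R : realType) (p : nat) (k : fieldType) (d n : nat)
    (Delta : {set {set 'I_n}}) (eps : {set 'I_n} -> bool)
    (deg : {mpoly (ratfield k d n)[n]} -> ratfield k d n)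
    (I : 'M[nat]_(d, n)) (J : 'M[nat]_(1, n))
    (p_prime : prime p) (char_k : p \in [pchar k])
    (Delta_pm : pseudomanifold R d Delta)
    (Delta_conn : connected_complex R Delta)
    (Delta_or : orientation k Delta eps)
    (deg_map : degree_map Delta eps deg)
    (I_sum : forall i, (\sum_j I i j)%N = p.-1)
    (J_sum : forall i, (\sum_j J i j)%N = d) :
  pderiv_mx I (deg 'X_[mx_expo J])
  = (-1) ^+ d * deg (mon_root _ p (mx_expo I + mx_expo J)%MM) ^+ p.
Proof.
have degJ : mdeg (mx_expo J) = d.
  rewrite mdegE -(J_sum ord0); apply: eq_bigr => j _.
  by rewrite mnmE big_ord1.
rewrite pderiv_mxE addmC -(word_weight_mx_word I).
exact: (deg_word_root Delta_pm Delta_or deg_map char_k (map_fst_mx_word I_sum)).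
Qed.
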